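(* Let $S$ be a subset of the unit sphere of a $d$-dimensional normed space ($d\geq 2$) and let $0<D\leq d/(2d-1)$ be given such that $\|x-y\|<D$ for all $x,y\in S$. Then $\|\widehat{p}-\widehat{q}\|<\left(2-\frac{1}{d}\right)D$ for any $p,q\in\operatorname{conv}(S)$.
   Context: All normed spaces are real. For a non-zero vector $x$, $\widehat{x}=\frac{1}{\|x\|}x$ denotes its normalization. $\operatorname{conv}(S)$ is the convex hull of $S$. (Under the hypotheses every point of $\operatorname{conv}(S)$ is non-zero, so that $\widehat p,\widehat q$ are defined; this is part of the assertion.) *)

(* Defs.v *)
From HB Require Import structures.
From mathcomp Require Import all_boot all_order all_algebra.
From mathcomp Require Import all_classical all_reals all_analysis.

Set Implicit Arguments.
Unset Strict Implicit.
Unset Printing Implicit Defensive.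

Import Order.TTheory GRing.Theory Num.Theory.
Import numFieldNormedType.Exports.

Local Open Scope classical_set_scope.
Local Open Scope ring_scope.

Definition unit_sphere (R : realType) (E : normedModType R) : set E :=
  [set x | `|x| = 1].
Arguments unit_sphere {R} E.

(* Junk value: [normalization 0 = 0]. *)
Definition normalization (R : realType) (E : normedModType R) (x : E) : E :=
  `|x|^-1 *: x.

(* [convex_set] is stated on the alias [convex_lmodType E] of [E], which
   carries the convex space structure [t *: x + (1 - t) *: y]. *)
Definition convex_hull (R : realType) (E : normedModType R) (S : set E) :
    set E :=
  smallest (fun A : set E => convex_set (A : set (convex_lmodType E))) S.

(* Main.v *)
(* Normalization only depends on the ray, so by the conic form of Caratheodory's
   theorem one may replace p and q by convex combinations of at most d points of
   S on the same rays.  Some coefficient of q is then at least 1/d, which puts q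
   within (1 - 1/d) D of a point of S, so |q| >= 1 - (1 - 1/d) D; also
   |p - q| < D.  If |q| <= |p|, the triangle inequality gives
     |p^ - q^| <= (|p - q| + |p| - |q|) / |p| = 1 + (|p - q| - |q|) / |p|,
   and |p - q| - |q| < (2 - 1/d) D - 1 <= 0 by the bound on D, so that |p| <= 1
   finishes the proof. *)
Require Import Defs.
From HB Require Import structures.
From mathcomp Require Import all_boot all_order all_algebra.
From mathcomp Require Import all_classical all_reals all_analysis.
From mathcomp Require Import ring lra.

Set Implicit Arguments.
Unset Strict Implicit.
Unset Printing Implicit Defensive.

Import Order.TTheory GRing.Theory Num.Theory.
Import numFieldNormedType.Exports.

Local Open Scope classical_set_scope.
Local Open Scope ring_scope.

(* [n] is only an upper bound on the number of points used: the points may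
   repeat and the coefficients may vanish. *)
Definition conic_comb (R : realType) (E : lmodType R) (S : set E) (n : nat)
    (s : R) (p : E) : Prop :=
  exists x : 'I_n -> E, exists l : 'I_n -> R,
    [/\ forall i, S (x i), forall i, 0 <= l i,
        \sum_i l i = s & \sum_i l i *: x i = p].

(** Convex combinations of points of [S] form a convex set containing [S]: two of them are mixed by
    concatenating their families, with coefficients scaled by [t] and [1 - t]. *)
Lemma convex_hull_comb (R : realType) (E : normedModType R) (S : set E) (p : E) :
  convex_hull S p -> exists n, conic_comb S n 1 p.
Proof.
apply: (smallest_sub (X := [set p | exists n, conic_comb S n 1 p])).
  move=> x y t; rewrite !inE => -[m [u [a [Su a0 a1 ax]]]].
  move=> [n [v [b [Sv b0 b1 bx]]]].
  exists (m + n)%N.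
  exists (fun i => match fintype.split i with inl j => u j | inr k => v k end).
  exists (fun i => match fintype.split i with
    inl j => t%:num * a j | inr k => (1 - t%:num) * b k end).
  have sl j : fintype.split (lshift n j) = inl j := @unsplitK m n (inl j).
  have sr k : fintype.split (rshift m k) = inr k := @unsplitK m n (inr k).
  have t1 : 0 <= 1 - t%:num by rewrite subr_ge0.
  split=> [i|i||].
  - by case: fintype.split => k.
  - by case: fintype.split => k; rewrite mulr_ge0.
  - rewrite big_split_ord /=.
    under eq_bigr do rewrite sl; under [X in _ + X]eq_bigr do rewrite sr.
    by rewrite -!mulr_sumr a1 b1 !mulr1 addrC subrK.
  - rewrite big_split_ord /=.
    under eq_bigr do rewrite sl -scalerA.
    under [X in _ + X]eq_bigr do rewrite sr -scalerA.
    by rewrite -!scaler_sumr ax bx.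
move=> x Sx; exists 1%N, (fun=> x), (fun=> 1); split=> //.
- by rewrite big_ord1.
- by rewrite big_ord1 scale1r.
Qed.

Lemma comb_size_gt0 (R : realType) (E : lmodType R) (S : set E) (n : nat)
    (p : E) : conic_comb S n 1 p -> (0 < n)%N.
Proof.
case: n => // -[x [l [_ _ /esym/eqP]]].
by rewrite big_ord0 oner_eq0.
Qed.

(** In coordinates the points are the rows of a matrix with more rows than columns, so its left
    kernel is non-zero; a change of sign makes some coefficient positive. *)
Lemma linear_dependence (R : realType) (d n : nat) (E : lmodType R)
    (dimE : Vector.axiom d E) (x : 'I_n -> E) : (d < n)%N ->
  exists2 c : 'I_n -> R, exists i, 0 < c i & \sum_i c i *: x i = 0.
Proof.
move=> dn; have [f flin [g fK gK]] := dimE.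
pose M := \matrix_(i < n) f (x i).
have : kermx M != 0.
  rewrite kermx_eq0 /row_free; apply/negP => /eqP rM.
  by have := rank_leq_col M; rewrite rM leqNgt dn.
case/rowV0Pn => u /sub_kermxP uM u0.
have fsum (c : 'I_n -> R) : f (\sum_i c i *: x i) = \sum_i c i *: f (x i).
  pose F : {linear E -> 'rV[R]_d} :=
    HB.pack f (GRing.isLinear.Build R E 'rV[R]_d *:%R f flin).
  by rewrite -[f]/(F : E -> _) linear_sum; apply: eq_bigr => i _; rewrite linearZ.
have ux : \sum_i u 0 i *: x i = 0.
  apply: (can_inj fK); rewrite fsum.
  have -> : f 0 = 0 by have := flin (-1) 0 0; rewrite scaler0 addr0 scaleN1r addNr.
  by rewrite -[RHS]uM mulmx_sum_row; apply: eq_bigr => i _; rewrite rowK.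
have [i ui] : exists i, u 0 i != 0 by apply/rV0Pn.
case: (ltgtP (u 0 i) 0) ui => // ui _.
- exists (fun j => - u 0 j); first by exists i; rewrite oppr_gt0.
  by under eq_bigr do rewrite scaleNr; rewrite sumrN ux oppr0.
- by exists (u 0) => //; exists i.
Qed.

(* Subtract the multiple of a linear dependence that first annihilates a
   coefficient. *)
Lemma conic_comb_drop (R : realType) (d n : nat) (E : lmodType R)
    (dimE : Vector.axiom d E) (S : set E) (s : R) (p : E) : (d <= n)%N ->
  conic_comb S n.+1 s p -> exists s', conic_comb S n s' p.
Proof.
move=> dn [x [l [Sx l0 _ lx]]].
have [c [i0 ci0] cx] := linear_dependence dimE x dn.
case: (Order.TotalTheory.arg_minP (fun i => l i / c i) (P := fun i => 0 < c i) ci0).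
move=> i ci imin; pose l' j := l j - l i / c i * c j.
have l'i : l' i = 0 by rewrite /l' divfK ?subrr// gt_eqF.
exists (\sum_j l' (lift i j)), (x \o lift i), (l' \o lift i); split=> //= [j|].
  rewrite /l'; set k := lift i j; rewrite subr_ge0.
  have [ck|ck] := ltP 0 (c k); first by rewrite -ler_pdivlMr// imin.
  by apply: le_trans (l0 k); rewrite mulr_ge0_le0// divr_ge0// ltW.
have : \sum_j l' j *: x j = p.
  under eq_bigr do rewrite scalerBl -scalerA.
  by rewrite sumrB -scaler_sumr cx scaler0 subr0.
by rewrite (bigD1_ord i)//= l'i scale0r add0r.
Qed.

(** Points are dropped while more than [d] remain. Using linear rather than affine dependence gives
    the bound [d] instead of [d + 1], at the price of losing control of the coefficient sum. *)
Lemma conic_caratheodory (R : realType) (d n : nat) (E : lmodType R)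
    (dimE : Vector.axiom d E) (S : set E) (s : R) (p : E) :
  conic_comb S n s p -> exists m s', (m <= d)%N /\ conic_comb S m s' p.
Proof.
elim: n s => [|n IH] s sp; first by exists 0%N, s.
have [nd|dn] := ltnP n d; first by exists n.+1, s.
by have [s' /IH] := conic_comb_drop dimE dn sp.
Qed.

(** Equality would make every term [l i * (D - f i)] vanish, hence every [l i], against the sum
    being 1. *)
Lemma sum_lt (R : realType) (n : nat) (l f : 'I_n -> R) (D : R) :
  (forall i, 0 <= l i) -> \sum_i l i = 1 -> (forall i, f i < D) ->
  \sum_i l i * f i < D.
Proof.
move=> l0 l1 fD; rewrite -subr_gt0 -[X in X - _]mul1r -l1 mulr_suml -sumrB.
have g0 i : true -> 0 <= l i * D - l i * f i.
  by move=> _; rewrite -mulrBr mulr_ge0// subr_ge0 ltW.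
rewrite lt_neqAle sumr_ge0 ?andbT//; apply/negP => /eqP/esym/(psumr_eq0P g0) h.
have : \sum_i l i = 0.
  apply: big1 => i _; have /eqP := h i isT.
  by rewrite -mulrBr mulf_eq0 subr_eq0 (gt_eqF (fD i)) orbF => /eqP.
by rewrite l1 => /eqP; rewrite oner_eq0.
Qed.

Lemma norm_sub_comb (R : realType) (E : normedModType R) (n : nat)
    (l : 'I_n -> R) (x : 'I_n -> E) (y : E) :
  (forall i, 0 <= l i) -> \sum_i l i = 1 ->
  `|\sum_i l i *: x i - y| <= \sum_i l i * `|x i - y|.
Proof.
move=> l0 l1; rewrite -[y in X in X <= _]scale1r -l1 scaler_suml -sumrB.
apply: le_trans (ler_norm_sum _ _ _) _; apply: ler_sum => i _.
by rewrite -scalerBr normrZ ger0_norm.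
Qed.

Lemma comb_dist_point (R : realType) (E : normedModType R) (S : set E) (D : R)
    (hD : forall x y : E, S x -> S y -> `|x - y| < D) (n : nat) (p y : E) :
  conic_comb S n 1 p -> S y -> `|p - y| < D.
Proof.
move=> [x [l [Sx l0 l1 <-]]] Sy; apply: le_lt_trans (norm_sub_comb _ _ l0 l1) _.
by apply: sum_lt => // i; apply: hD.
Qed.

Lemma comb_dist (R : realType) (E : normedModType R) (S : set E) (D : R)
    (hD : forall x y : E, S x -> S y -> `|x - y| < D) (m n : nat) (p q : E) :
  conic_comb S m 1 p -> conic_comb S n 1 q -> `|p - q| < D.
Proof.
move=> Sp [x [l [Sx l0 l1 <-]]]; rewrite distrC.
apply: le_lt_trans (norm_sub_comb _ _ l0 l1) _.
by apply: sum_lt => // i; rewrite distrC; apply: (comb_dist_point hD Sp).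
Qed.

(* Some coefficient is at least [1/n], and the corresponding point is close. *)
Lemma comb_norm_ge (R : realType) (E : normedModType R) (S : set E) (D : R)
    (hD : forall x y : E, S x -> S y -> `|x - y| < D) (n : nat) (p : E) :
  S `<=` unit_sphere E ->
  conic_comb S n 1 p -> 1 - (1 - n%:R^-1) * D <= `|p|.
Proof.
move=> hS Sp; have n0 := comb_size_gt0 Sp; have [x [l [Sx l0 l1 <-]]] := Sp.
have [i li] : exists i, n%:R^-1 <= l i.
  apply: contrapT => /forallNP h; suff : \sum_i l i < 1 by rewrite l1 ltxx.
  apply: (@lt_le_trans _ _ (\sum_(i < n) n%:R^-1)).
    apply: ltr_sum => [|j _]; last by rewrite ltNge; apply/negP.
    by apply/hasP; exists (Ordinal n0); rewrite ?mem_index_enum.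
  by rewrite sumr_const card_ord -[leLHS]mulr_natr mulVf// pnatr_eq0 -lt0n.
have D0 : 0 < D by have := hD _ _ (Sx i) (Sx i); rewrite subrr normr0.
have : `|\sum_j l j *: x j - x i| <= (1 - l i) * D.
  apply: le_trans (norm_sub_comb _ _ l0 l1) _.
  (* The term at [i] vanishes, so only the weight [1 - l i] of the other points counts. *)
  rewrite (bigD1 i)//= subrr normr0 mulr0 add0r -l1 [in leRHS](bigD1 i)//=.
  rewrite addrAC subrr add0r mulr_suml.
  by apply: ler_sum => j _; rewrite ler_wpM2l// ltW// hD.
have xi : `|x i| = 1 := hS _ (Sx i).
have := lerB_dist (x i) (x i - \sum_j l j *: x j).
rewrite subKr xi [`|x i - _|]distrC.
have : (1 - l i) * D <= (1 - n%:R^-1) * D by rewrite ler_wpM2r ?lerB// ltW.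
lra.
Qed.

Lemma normalizationZ (R : realType) (E : normedModType R) (t : R) (p : E) :
  0 < t -> normalization (t *: p) = normalization p.
Proof.
move=> t0; rewrite /normalization normrZ gtr0_norm// scalerA invfM.
by rewrite mulrAC mulVf ?mul1r// gt_eqF.
Qed.

Lemma normalization_dist (R : realType) (E : normedModType R) (p q : E) :
  q != 0 -> `|q| <= `|p| ->
  `|normalization p - normalization q| <= 1 + (`|p - q| - `|q|) / `|p|.
Proof.
move=> q0 qp; have qn : 0 < `|q| by rewrite normr_gt0.
have pn : 0 < `|p| := lt_le_trans qn qp.
rewrite /normalization.
(* The second summand is a multiple of [q] of norm [1 - |q| / |p|]. *)
have -> : `|p|^-1 *: p - `|q|^-1 *: q =
    `|p|^-1 *: (p - q) - (`|q|^-1 - `|p|^-1) *: q.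
  by rewrite scalerBr scalerBl opprB addrA subrK.
apply: le_trans (ler_normB _ _) _.
rewrite !normrZ !ger0_norm ?invr_ge0 ?subr_ge0 ?lef_pV2 ?posrE//.
by rewrite le_eqVlt; apply/orP; left; apply/eqP; field; rewrite !gt_eqF.
Qed.

(** The coefficient sum left by the conic reduction is positive because [p] is non-zero; dividing by
    it gives a convex combination on the same ray. *)
Lemma convex_hull_rescale (R : realType) (d : nat) (E : normedModType R)
    (dimE : Vector.axiom d E) (S : set E) (p : E) : convex_hull S p -> p != 0 ->
  exists n t, [/\ (n <= d)%N, 0 < t & conic_comb S n 1 (t *: p)].
Proof.
move=> /convex_hull_comb[n /(conic_caratheodory dimE)[m [s [md]]]].
move=> [x [l [Sx l0 ls lx]]] p0.
have s0 : 0 < s.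
  rewrite lt_neqAle -ls sumr_ge0 ?andbT//; apply: contra_neqN p0 => /eqP/esym h.
  rewrite -lx big1// => i _.
  by rewrite (psumr_eq0P (fun i _ => l0 i) h) ?scale0r.
exists m, s^-1; split; rewrite ?invr_gt0//.
exists x, (fun i => s^-1 * l i); split=> // [i||].
- by rewrite mulr_ge0// invr_ge0 ltW.
- by rewrite -mulr_sumr ls mulVf// gt_eqF.
- by under eq_bigr do rewrite -scalerA; rewrite -scaler_sumr lx.
Qed.

Theorem theorem35 (R : realType) (d : nat) (hd : (2 <= d)%N)
  (E : normedModType R) (dimE : Vector.axiom d E)
  (S : set E) (hS : S `<=` unit_sphere E)
  (D : R) (D_gt0 : 0 < D) (D_le : D <= d%:R / (2 * d%:R - 1))
  (hD : forall x y : E, S x -> S y -> `|x - y| < D) :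
  (forall p : E, convex_hull S p -> p != 0) /\
  (forall p q : E, convex_hull S p -> convex_hull S q ->
     `|normalization p - normalization q| < (2 - d%:R^-1) * D).
Proof.
have d0 : 0 < d%:R :> R by rewrite ltr0n (leq_trans _ hd).
have d2 : 2 <= d%:R :> R by rewrite ler_nat.
(* This is the bound on [D] rewritten, as [d / (2d - 1)] is the inverse of [2 - 1/d]. *)
have D1 : (2 - d%:R^-1) * D <= 1.
  have e0 : 0 < 2 - d%:R^-1 :> R.
    by rewrite subr_gt0 (@lt_le_trans _ _ 1) ?invf_lt1//; lra.
  rewrite mulrC -ler_pdivlMr//; apply: le_trans D_le _; rewrite le_eqVlt.
  by apply/orP; left; apply/eqP; field; rewrite !gt_eqF//; lra.
have di : d%:R^-1 <= 2^-1 :> R by rewrite lef_pV2 ?posrE.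
have Dlt1 : D < 1 by nra.
(* If 0 were in the hull, it would lie within [D < 1] of a point of [S], which has norm 1. *)
have p0 p : convex_hull S p -> p != 0.
  move=> /convex_hull_comb[n]; apply: contraPneq => -> Sp.
  have [x [_ [Sx _ _ _]]] := Sp; have Sy := Sx (Ordinal (comb_size_gt0 Sp)).
  have := comb_dist_point hD Sp Sy.
  by rewrite sub0r normrN (hS _ Sy) ltNge ltW.
split=> // p q hp hq.
have [m [s [md s0 Sp]]] := convex_hull_rescale dimE hp (p0 _ hp).
have [n [t [nd t0 Sq]]] := convex_hull_rescale dimE hq (p0 _ hq).
rewrite -(normalizationZ p s0) -(normalizationZ q t0).
have : s *: p != 0 by rewrite scaler_eq0 gt_eqF//= p0.
have : t *: q != 0 by rewrite scaler_eq0 gt_eqF//= p0.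
(* From here on [p] and [q] denote the rescaled points. *)
move: (s *: p) (t *: q) Sp Sq => {s0 t0 s t hp hq}p {}q Sp Sq q0 {}p0.
wlog qp : p q m n md nd Sp Sq p0 q0 / `|q| <= `|p|.
  move=> H; case: (leP `|q| `|p|) => [|/ltW] pq; first exact: (H p q m n).
  by rewrite distrC; exact: (H q p n m).
apply: le_lt_trans (normalization_dist q0 qp) _.
have pn : 0 < `|p| by rewrite normr_gt0.
have p1 : `|p| <= 1.
  have [x [l [Sx l0 l1 <-]]] := Sp.
  apply: le_trans (ler_norm_sum _ _ _) _; rewrite -l1; apply: ler_sum => i _.
  by rewrite normrZ ger0_norm// (hS _ (Sx i)) mulr1.
have qge := comb_norm_ge hD hS Sq.
have n0 := comb_size_gt0 Sq.
have dn : (d%:R^-1 : R) <= n%:R^-1.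
  by rewrite lef_pV2 ?posrE ?d0 ?ltr0n ?n0 ?ler_nat.
have pq := comb_dist hD Sp Sq.
rewrite addrC -ltrBrDr ltr_pdivrMr//.
have h1 : (1 - n%:R^-1) * D <= (1 - d%:R^-1) * D by rewrite ler_wpM2r ?lerB// ltW.
(* With [c = (2 - 1/d) D], this says [c - 1 <= (c - 1) |p|], while the earlier bounds add up to
   [|p - q| - |q| < c - 1]. *)
have h2 : 0 <= (1 - (2 - d%:R^-1) * D) * (1 - `|p|) by rewrite mulr_ge0// subr_ge0.
lra.
Qed.
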